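(* If a position in infinite Hex has a game value (for one of the players), then it is intrinsically local (for that player).
   Context: Board: the infinite hexagonal lattice. Tiles are indexed by $(a,b)\in\mathbb{Z}^2$, tile $(a,b)$ being centered at $(x,y)=(a+\tfrac{b}{2},\tfrac{\sqrt3}{2}b)$; it is adjacent to $(a\pm1,b)$, $(a,b\pm1)$, $(a+1,b-1)$, $(a-1,b+1)$. Infinite Hex: Red and Blue alternately place one stone of their own color on an empty tile; stones are never moved or removed. A position consists of an arbitrary partial coloring of the tiles by red and blue (possibly with infinitely many stones) together with the information whose turn it is. A red $\mathbb{Z}$-chain is a sequence $(h_n)_{n\in\mathbb{Z}}$ of red tiles with $h_n$ adjacent to $h_{n+1}$ for all $n$; similarly for blue. Red's winning condition: there is a red $\mathbb{Z}$-chain converging to $(\infty,\infty)$ as $n\to+\infty$ (both coordinates of the tile centers tend to $+\infty$) and to $(-\infty,-\infty)$ as $n\to-\infty$. Blue's winning condition: there is a blue $\mathbb{Z}$-chain converging to $(-\infty,\infty)$ at one end and to $(\infty,-\infty)$ at the other. Game value for a player $P$ (an ordinal, defined by recursion for some positions): a position has value $0$ if the game is already won for $P$, i.e. the stones of $P$ already on the board fulfill $P$'s winning condition (so that no subsequent moves can prevent the win). If the position is not already won, it is $P$'s turn, and $P$ has a move to a position with a value, then with $\alpha$ the minimal value of such a position, the value is $\alpha+1$. If the position is not already won, it is the opponent's turn, there is at least one legal move, and every legal move leads to a position with a value, then the value is the supremum of those values. Positions not assigned a value in this way have no game value for $P$. Intrinsically local: a position is intrinsically local for $P$ if there is a finite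 set $D$ of tiles such that, from this position, $P$ can win by playing only on tiles of $D$ and paying attention only to the opponent's moves in $D$ (opponent's moves outside $D$ are ignored, and may be treated as imaginary moves in $D$); the win is achieved, with such play, at the latest when $D$ is filled with stones. *)

(* Defs.v *)
From Stdlib Require Import Reals ZArith List Classical.
From Coquelicot Require Import Coquelicot.

(** * Ordinals *)

(** [osup A f] is the least ordinal strictly above all the [f i].  Every ordinal
    is of this form; distinct terms may denote the same ordinal, so equality of
    ordinals is [oeq], not Leibniz equality. *)
Inductive ord : Type := osup (A : Type) (f : A -> ord).

Fixpoint ole (a b : ord) : Prop :=
  match a with osup A f =>
    forall i : A, match b with osup B g => exists j : B, ole (f i) (g j) end
  end.

Definition olt (a b : ord) : Prop :=
  match b with osup B g => exists j : B, ole a (g j) end.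

Definition oeq (a b : ord) : Prop := ole a b /\ ole b a.

Definition ozero : ord := osup Empty_set (fun e => match e with end).
Definition osucc (a : ord) : ord := osup unit (fun _ => a).

Definition is_omin (S : ord -> Prop) (a : ord) : Prop :=
  S a /\ forall b, S b -> ole a b.

Definition is_osup (S : ord -> Prop) (a : ord) : Prop :=
  (forall b, S b -> ole b a) /\
  forall c, (forall b, S b -> ole b c) -> ole a c.

(** * The board *)

Definition tile : Type := (Z * Z)%type.

Definition center_x (t : tile) : R := (IZR (fst t) + IZR (snd t) / 2)%R.
Definition center_y (t : tile) : R := (sqrt 3 / 2 * IZR (snd t))%R.

Definition adjacent (s t : tile) : Prop :=
  let (a, b) := s in
  In t ((a + 1, b) :: (a - 1, b) :: (a, b + 1) :: (a, b - 1) ::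
        (a + 1, b - 1) :: (a - 1, b + 1) :: nil)%Z.

Definition tile_eq_dec (s t : tile) : {s = t} + {s <> t}.
Proof. decide equality; apply Z.eq_dec. Defined.

(** * Infinite Hex *)

Inductive player : Type := Red | Blue.

Definition opponent (P : player) : player :=
  match P with Red => Blue | Blue => Red end.

Definition coloring : Type := tile -> option player.

Record position : Type := Position { stones : coloring; turn : player }.

Definition legal (p : position) (t : tile) : Prop := stones p t = None.

Definition play (p : position) (t : tile) : position :=
  Position (fun s => if tile_eq_dec s t then Some (turn p) else stones p s)
           (opponent (turn p)).

Definition is_chain (c : coloring) (P : player) (h : Z -> tile) : Prop :=
  forall n : Z, c (h n) = Some P /\ adjacent (h n) (h (n + 1)%Z).

Definition tiles_tend_to (u : nat -> tile) (x y : Rbar) : Prop :=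
  is_lim_seq (fun n => center_x (u n)) x /\
  is_lim_seq (fun n => center_y (u n)) y.

(** Adjacency is symmetric, so a chain may be reversed: for Blue it does not
    matter which of the two ends is taken to be the one at [n -> +oo]. *)
Definition wins (P : player) (c : coloring) : Prop :=
  exists h : Z -> tile, is_chain c P h /\
    match P with
    | Red =>
        tiles_tend_to (fun n => h (Z.of_nat n)) p_infty p_infty /\
        tiles_tend_to (fun n => h (- Z.of_nat n)%Z) m_infty m_infty
    | Blue =>
        tiles_tend_to (fun n => h (Z.of_nat n)) m_infty p_infty /\
        tiles_tend_to (fun n => h (- Z.of_nat n)%Z) p_infty m_infty
    end.

(** * Game values *)

(** The values reached by one legal move from [p], where [V q a] reads "the
    position [q] has value [a]". *)
Definition option_values (V : position -> ord -> Prop) (p : position)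
    (a : ord) : Prop :=
  exists t, legal p t /\ V (play p t) a.

Definition value_rule (P : player) (V : position -> ord -> Prop)
    (p : position) (a : ord) : Prop :=
  (wins P (stones p) /\ oeq a ozero) \/
  (~ wins P (stones p) /\ turn p = P /\
   exists b, is_omin (option_values V p) b /\ oeq a (osucc b)) \/
  (~ wins P (stones p) /\ turn p = opponent P /\
   (exists t, legal p t) /\
   (forall t, legal p t -> exists b, V (play p t) b) /\
   is_osup (option_values V p) a).

(** The recursion is on ordinals: whether [value_rule P V p a] holds depends only
    on [V] at ordinals [b < a] when it is the turn of [P], and on [V] at ordinals
    [b <= a] and positions where it is the turn of [P] otherwise.  It therefore
    determines [V]: see [value_recursion_exists] and [value_recursion_unique]. *)
Definition value_recursion (P : player) (V : position -> ord -> Prop) : Prop :=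
  forall p a, V p a <-> value_rule P V p a.

Definition game_value (P : player) (p : position) (a : ord) : Prop :=
  exists V, value_recursion P V /\ V p a.

Definition has_game_value (P : player) (p : position) : Prop :=
  exists a, game_value P p a.

(** * Intrinsically local positions *)

Definition filled (D : list tile) (c : coloring) : Prop :=
  forall t, In t D -> c t <> None.

(** A strategy that sees only the tiles of [D] and plays only on them. *)
Definition local_strategy (D : list tile) (sigma : coloring -> tile) : Prop :=
  (forall c c', (forall t, In t D -> c t = c' t) -> sigma c = sigma c') /\
  (forall c, ~ filled D c -> In (sigma c) D /\ c (sigma c) = None).

(** The positions that can arise from [p] when [P] follows [sigma] until [D] is
    filled; the opponent may make any legal move, in [D] or outside [D]. *)
Inductive arises (P : player) (D : list tile) (sigma : coloring -> tile)
    (p : position) : position -> Prop :=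
| arises_start : arises P D sigma p p
| arises_own q : arises P D sigma p q -> turn q = P -> ~ filled D (stones q) ->
    arises P D sigma p (play q (sigma (stones q)))
| arises_opponent q t : arises P D sigma p q -> turn q = opponent P ->
    legal q t -> arises P D sigma p (play q t).

(** Each move of [P] fills a tile of [D], so every continued play does fill [D],
    and the last clause makes it a win for [P] by then at the latest. *)
Definition intrinsically_local (P : player) (p : position) : Prop :=
  exists (D : list tile) (sigma : coloring -> tile),
    local_strategy D sigma /\
    forall q, arises P D sigma p q -> filled D (stones q) ->
      wins P (stones q).

(** * Ordinals have suprema; the recursion has exactly one solution *)

Lemma ole_refl a : ole a a.
Proof. induction a as [I f IH]; intros i; exists i; apply IH. Qed.

Lemma ole_trans a b c : ole a b -> ole b c -> ole a c.
Proof.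
  revert b c; induction a as [I f IH]; intros [J g] [K h] H1 H2 i.
  destruct (H1 i) as [j Hj]; destruct (H2 j) as [k Hk]; exists k; eauto.
Qed.

Lemma olt_ole_trans a b c : olt a b -> ole b c -> olt a c.
Proof.
  destruct b as [J g], c as [K h]; intros [j Hj] H.
  destruct (H j) as [k Hk]; exists k; eapply ole_trans; eauto.
Qed.

Lemma ole_olt_trans a b c : ole a b -> olt b c -> olt a c.
Proof. destruct c as [K h]; intros H [k Hk]; exists k; eapply ole_trans; eauto. Qed.

Lemma olt_osucc a : olt a (osucc a).
Proof. exists tt; apply ole_refl. Qed.

Lemma osucc_ole a b : ole (osucc a) b <-> olt a b.
Proof. destruct b; split; [intros H; exact (H tt) | intros H []; exact H]. Qed.

Lemma ozero_ole a : ole ozero a.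
Proof. intros []. Qed.

Lemma olt_wf : well_founded olt.
Proof.
  assert (H : forall a b, ole b a -> Acc olt b).
  { induction a as [I f IH]; intros [J g] Hb; constructor; intros c [j Hc].
    destruct (Hb j) as [i Hi]; apply (IH i); eapply ole_trans; eauto. }
  intros a; apply (H a a), ole_refl.
Qed.

Lemma olt_ole a b : olt a b -> ole a b.
Proof.
  assert (H : forall c, match c with osup B g => forall j, ole (g j) c end).
  { induction c as [B g IH]; intros j; specialize (IH j).
    destruct (g j) as [C h] eqn:E; intros k; exists j; rewrite E; apply IH. }
  destruct b as [B g]; intros [j Hj].
  exact (ole_trans _ _ _ Hj (H (osup B g) j)).
Qed.

Lemma ole_or_olt a b : ole a b \/ olt b a.
Proof.
  revert b; induction a as [I f IH]; intros b.
  destruct (classic (exists i, ole b (f i))) as [H | H]; [right; exact H | left].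
  destruct b as [J g]; intros i.
  destruct (classic (exists j, ole (f i) (g j))) as [K | K]; [exact K |].
  exfalso; apply H; exists i.
  assert (L : forall j, olt (g j) (f i)).
  { intros j; destruct (IH i (g j)); [exfalso; eauto | assumption]. }
  cbn; intros j; specialize (L j); destruct (f i); exact L.
Qed.

Lemma olt_irrefl a : ~ olt a a.
Proof. induction (olt_wf a) as [a _ IH]; intros H; exact (IH a H H). Qed.

Lemma omin_exists (S : ord -> Prop) :
  (exists a, S a) -> exists a, S a /\ forall b, S b -> ole a b.
Proof.
  intros [a Ha]; induction (olt_wf a) as [a _ IH].
  destruct (classic (exists b, S b /\ olt b a)) as [[b [Hb K]] | K]; [eauto |].
  exists a; split; [exact Ha |]; intros b Hb.
  destruct (ole_or_olt a b); [assumption | exfalso; eauto].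
Qed.

Lemma osup_exists (I : Type) (f : I -> ord) :
  exists a, is_osup (fun b => exists i, b = f i) a.
Proof.
  set (pred_ix := fun a => match a with osup B _ => B end).
  set (pred := fun a => match a return pred_ix a -> ord with osup B g => g end).
  exists (osup {i : I & pred_ix (f i)} (fun x => pred _ (projT2 x))).
  split.
  - intros b [i ->]; destruct (f i) as [J g] eqn:E; intros j.
    assert (L : forall c, c = f i -> ole c c -> forall k : pred_ix c,
              exists x : {i : I & pred_ix (f i)},
                ole (pred c k) (pred _ (projT2 x))).
    { intros c -> _ k; exists (existT _ i k); apply ole_refl. }
    exact (L (osup J g) (eq_sym E) (ole_refl _) j).
  - intros c Hc [i k]; specialize (Hc _ (ex_intro _ i eq_refl)); simpl.
    revert k Hc; destruct (f i) as [J g]; intros k Hc; exact (Hc k).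
Qed.

(** [value_le P p a]: the position [p] has a value, and it is at most [a]. *)
Inductive value_le (P : player) : position -> ord -> Prop :=
| value_le_won p a : wins P (stones p) -> value_le P p a
| value_le_own p a b t : turn p = P -> legal p t -> olt b a ->
    value_le P (play p t) b -> value_le P p a
| value_le_opp p a : turn p = opponent P -> (exists t, legal p t) ->
    (forall t, legal p t -> value_le P (play p t) a) -> value_le P p a.

Lemma opponent_neq P : P <> opponent P.
Proof. destruct P; discriminate. Qed.

Lemma value_le_mono P p a b : value_le P p a -> ole a b -> value_le P p b.
Proof.
  intros H; revert b; induction H; intros b' Hb.
  - now apply value_le_won.
  - eapply value_le_own; eauto using olt_ole_trans.
  - apply value_le_opp; auto.
Qed.

Lemma value_recursion_exists P : exists V, value_recursion P V.
Proof.
  set (V := fun p a => value_le P p a /\ forall b, value_le P p b -> ole a b).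
  assert (Vmin : forall p a, value_le P p a -> exists b, V p b /\ ole b a).
  { intros p a H.
    destruct (omin_exists (value_le P p) (ex_intro _ a H)) as [b [Hb K]].
    exists b; split; [split |]; auto. }
  exists V; intros p a; split.
  - intros [H Hmin]; destruct (classic (wins P (stones p))) as [W | W].
    { left; split; [exact W | split; [| apply ozero_ole]].
      apply Hmin, value_le_won, W. }
    right; inversion H as [? ? W' | ? ? b t T L B K | ? ? T E K]; subst.
    + contradiction.
    + left; split; [exact W | split; [reflexivity |]].
      destruct (omin_exists (fun b => option_values V p b)) as [m [[s [Ls Vs]] M]].
      { destruct (Vmin _ _ K) as [b' [Vb _]]; exists b', t; auto. }
      exists m; split; [split; [exists s; auto | exact M] | split].
      * apply Hmin, value_le_own with m s; auto using olt_osucc; apply Vs.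
      * apply osucc_ole; destruct (Vmin _ _ K) as [b' [Vb B']].
        apply ole_olt_trans with b; [| exact B].
        apply ole_trans with b'; [apply M; exists t; auto | exact B'].
    + right; split; [exact W | split; [exact T | split; [exact E | split]]].
      { intros t L; destruct (Vmin _ _ (K t L)) as [b [Vb _]]; eauto. }
      split.
      * intros b [t [L Vb]]; apply Vb, K, L.
      * intros c Hc; apply Hmin, value_le_opp; auto; intros t L.
        destruct (Vmin _ _ (K t L)) as [b [Vb _]].
        apply value_le_mono with b; [apply Vb | apply Hc; exists t; auto].
  - intros [[W Ha] | [[W [T [b [[[t [L Vt]] M] Ha]]]] | [W [T [E [K [S1 S2]]]]]]].
    + split; [apply value_le_won, W |].
      intros b _; apply ole_trans with ozero; [apply Ha | apply ozero_ole].
    + split.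
      * apply value_le_own with b t; auto; [| apply Vt].
        exact (proj1 (osucc_ole _ _) (proj2 Ha)).
      * intros c Hc; apply ole_trans with (osucc b); [apply Ha |].
        apply osucc_ole.
        inversion Hc as [? ? W' | ? ? d s T' L' B Kd | ? ? T' ? ?]; subst.
        -- contradiction.
        -- apply ole_olt_trans with d; [| exact B].
           destruct (Vmin _ _ Kd) as [d' [Vd D]].
           apply ole_trans with d'; [apply M; exists s; auto | exact D].
        -- exfalso; exact (opponent_neq _ T').
    + split.
      * apply value_le_opp; auto; intros t L; destruct (K t L) as [b Vb].
        apply value_le_mono with b; [apply Vb | apply S1; exists t; auto].
      * intros c Hc; apply S2; intros b [t [L Vb]]; apply Vb.
        inversion Hc as [? ? W' | ? ? d s T' L' B Kd | ? ? T' ? Kc]; subst.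
        -- contradiction.
        -- exfalso; apply (opponent_neq (turn p)); congruence.
        -- auto.
Qed.

Lemma value_recursion_unique P V V' :
  value_recursion P V -> value_recursion P V' -> forall p a, V p a <-> V' p a.
Proof.
  intros HV HV'.
  assert (Own : forall U U' p a, value_recursion P U -> value_recursion P U' ->
      (forall b q, olt b a -> U q b <-> U' q b) -> turn p = P ->
      U p a -> U' p a).
  { intros U U' p a HU HU' IH T H; apply HU in H; apply HU'.
    destruct H as [H | [[W [_ [b [[[t [L Ub]] M] Ha]]]] | [_ [T' _]]]].
    - left; exact H.
    - assert (B : olt b a) by exact (proj1 (osucc_ole _ _) (proj2 Ha)).
      right; left; split; [exact W | split; [exact T |]].
      exists b; split; [split | exact Ha].
      + exists t; split; [exact L | apply IH; assumption].
      + intros c [s [Ls Uc]]; destruct (ole_or_olt b c) as [K | K]; [exact K |].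
        apply M; exists s; split; [exact Ls |]; apply IH; [| exact Uc].
        apply olt_ole_trans with b; [exact K | apply olt_ole, B].
    - exfalso; rewrite T in T'; exact (opponent_neq _ T'). }
  assert (Opp : forall U U' p a, value_recursion P U -> value_recursion P U' ->
      (forall b q, ole b a -> turn q = P -> U q b <-> U' q b) ->
      turn p = opponent P -> U p a -> U' p a).
  { intros U U' p a HU HU' IH T H; apply HU in H; apply HU'.
    assert (T1 : forall t, turn (play p t) = P).
    { intros t; simpl; rewrite T; destruct P; reflexivity. }
    destruct H as [H | [[_ [T' _]] | [W [_ [E [K [S1 S2]]]]]]].
    - left; exact H.
    - exfalso; apply (opponent_neq P); congruence.
    - right; right; split; [exact W | split; [exact T | split; [exact E |]]].
      assert (K' : forall t, legal p t ->
                exists b, ole b a /\ U (play p t) b /\ U' (play p t) b).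
      { intros t L; destruct (K t L) as [b Ub].
        assert (B : ole b a) by (apply S1; exists t; auto).
        exists b; split; [exact B | split; [exact Ub |]].
        apply IH; auto. }
      split; [intros t L; destruct (K' t L) as [b [_ [_ Ub]]]; eauto |].
      assert (Uniq : forall q b c, U' q b -> U' q c -> turn q = P -> ole b c).
      { intros q b c Hb Hc Tq; apply HU' in Hb; apply HU' in Hc.
        destruct Hb as [[Wb Eb] | [[Wb [_ [b' [[Sb Mb] Eb]]]] | [_ [Tb _]]]];
          [| | exfalso; rewrite Tq in Tb; exact (opponent_neq _ Tb)].
        - apply ole_trans with ozero; [apply Eb | apply ozero_ole].
        - destruct Hc as [[Wc Ec] | [[Wc [_ [c' [[Sc Mc] Ec]]]] | [_ [Tc _]]]];
            [contradiction | | exfalso; rewrite Tq in Tc; exact (opponent_neq _ Tc)].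
          apply ole_trans with (osucc b'); [apply Eb |].
          apply osucc_ole, ole_olt_trans with c'; [apply Mb, Sc |].
          exact (proj1 (osucc_ole _ _) (proj2 Ec)). }
      split.
      + intros b [t [L Ub]]; destruct (K' t L) as [c [Hc [_ Uc]]].
        apply ole_trans with c; [| exact Hc]; eapply Uniq; eauto.
      + intros c Hc; apply S2; intros b [t [L Ub]]; apply Hc; exists t.
        split; [exact L |]; apply IH; auto; apply S1; exists t; auto. }
  assert (Main : forall a p, V p a <-> V' p a).
  { intros a; induction (olt_wf a) as [a _ IH].
    assert (IHown : forall p, turn p = P -> V p a <-> V' p a).
    { intros p T; split; [apply (Own V V') | apply (Own V' V)]; auto.
      intros b q B; symmetry; auto. }
    intros p; destruct (classic (turn p = P)) as [T | T]; [auto |].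
    assert (T' : turn p = opponent P) by (destruct (turn p), P; simpl; congruence).
    assert (IHle : forall b q, ole b a -> turn q = P -> V q b <-> V' q b).
    { intros b q B Tq; destruct (ole_or_olt a b) as [C | C]; [| auto].
      split; intros H; (eapply Own; [| | | exact Tq | exact H]; auto);
        intros c r D; [| symmetry]; apply IH; eapply olt_ole_trans; eauto. }
    split; [apply (Opp V V') | apply (Opp V' V)]; auto.
    intros b q B Tq; symmetry; auto. }
  intros p a; apply Main.
Qed.

(* Main.v *)
From Stdlib Require Import ZArith List Classical ClassicalEpsilon.
From Stdlib Require Import FunctionalExtensionality.
Require Import Defs.

(** A winning condition of Hex only speaks of the player's own stones, and more
    of them never hurt ([wins_mono]).  Hence one may consider, for a finite set
    [D] of tiles, the game in which [P] must move in [D] while the opponent may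
    move in [D] or pass; [forces P D p] says that [P] wins it from [p].  The pass
    stands for every move of the opponent outside [D].

    A position with a game value is forced in some finite [D].  This goes by
    induction on the value.  If the position is won, [D] is empty; if [P] moves to
    a position forced in [D], add the tile played to [D].  The interesting case is
    the opponent's turn, where infinitely many moves each come with a finite set
    of their own.  Pick any one legal move [t0], with finite set [D0].  Against a
    move outside [D0], player [P] can pretend that it was played at [t0]: the
    answer in [D0] still wins, because a missing stone at [t0] is only an
    advantage and a stone outside [D0] is irrelevant.  So only the finitely many
    moves inside [D0] need sets of their own, and the union of these with [D0]
    works ([forces_opponent_turn]).  Both this and the passage to a larger
    finite set are instances of one comparison lemma, [forces_better].

    Conversely, forcing in [D] yields a strategy that only looks at [D]: move so
    that the position remains forced, where the unseen stones outside [D] are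
    taken to be those of the initial position.  That guess is right about the
    stones of [P], which never plays outside [D], and no others matter
    ([forces_intrinsically_local]). *)

(** * The game restricted to a finite set of tiles *)

Definition pass (p : position) : position :=
  Position (stones p) (opponent (turn p)).

Inductive forces (P : player) (D : list tile) : position -> Prop :=
| forces_won p : wins P (stones p) -> forces P D p
| forces_own p t : turn p = P -> In t D -> legal p t ->
    forces P D (play p t) -> forces P D p
| forces_opp p : turn p = opponent P -> forces P D (pass p) ->
    (forall t, In t D -> legal p t -> forces P D (play p t)) -> forces P D p.

(** The order in which [forces P D] is monotone.  The last clause is limited to
    [D] because [P] never needs a free tile elsewhere: outside [D] the opponent's
    stones and the empty tiles are interchangeable. *)
Definition better (P : player) (D : list tile) (p q : position) : Prop :=
  turn q = turn p /\
  (forall t, stones p t = Some P -> stones q t = Some P) /\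
  (forall t, In t D -> stones p t = None -> stones q t <> Some (opponent P)).

Lemma opponent_involutive P : opponent (opponent P) = P.
Proof. now destruct P. Qed.

Lemma neq_opponent X P : X <> P -> X = opponent P.
Proof. destruct X, P; simpl; congruence. Qed.

Lemma wins_mono P c c' :
  (forall t, c t = Some P -> c' t = Some P) -> wins P c -> wins P c'.
Proof.
  intros Hc [h [Hh Hlim]]; exists h; split; [| exact Hlim].
  intros n; destruct (Hh n) as [H1 H2]; auto.
Qed.

Lemma wins_play P p t : legal p t -> wins P (stones p) -> wins P (stones (play p t)).
Proof.
  intros L; apply wins_mono; intros s Hs; simpl.
  destruct (tile_eq_dec s t) as [-> |]; [| exact Hs].
  unfold legal in L; congruence.
Qed.

Lemma not_filled_free D c : ~ filled D c -> exists t, In t D /\ c t = None.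
Proof.
  intros H; apply NNPP; intros K; apply H; intros t Ht E; apply K; eauto.
Qed.

Lemma forces_filled P D p : forces P D p -> filled D (stones p) -> wins P (stones p).
Proof.
  intros H; induction H as [p W | p t T I L _ _ | p T _ IH _]; intros F.
  - exact W.
  - destruct (F t I L).
  - exact (IH F).
Qed.

Lemma better_pass P D p q : better P D p q -> better P D (pass p) (pass q).
Proof. intros [T [B1 B2]]; split; [simpl; congruence | split; assumption]. Qed.

Lemma better_play P D p q t :
  better P D p q -> legal q t -> better P D (play p t) (play q t).
Proof.
  intros [T [B1 B2]] L; split; [simpl; congruence | split]; intros s; simpl;
    rewrite T; destruct (tile_eq_dec s t); auto; discriminate.
Qed.

Lemma better_trans P D p q r : better P D p q -> better P D q r -> better P D p r.
Proof.
  intros [T [B1 B2]] [T' [C1 C2]]; split; [congruence | split; [auto |]].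
  intros t I L E; specialize (B2 t I L).
  destruct (stones q t) as [X |] eqn:Q; [| exact (C2 t I Q E)].
  destruct (classic (X = P)) as [-> | N].
  - rewrite (C1 t Q) in E; injection E; apply opponent_neq.
  - apply B2; f_equal; exact (neq_opponent _ _ N).
Qed.

Lemma better_pass_owned P D p q t :
  better P D p q -> turn p = P -> stones q t = Some P ->
  better P D (play p t) (pass q).
Proof.
  intros [T [B1 B2]] TP Ht; split; [simpl; congruence | split]; intros s; simpl;
    destruct (tile_eq_dec s t) as [-> |]; auto; discriminate.
Qed.

Lemma better_extra_move P D q s :
  turn q = P -> legal q s -> better P D (pass q) (play q s).
Proof.
  intros T L; unfold legal in L; split; [reflexivity | split]; intros r; simpl;
    rewrite T; destruct (tile_eq_dec r s) as [-> |]; try congruence.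
  intros _ _ E; injection E; apply opponent_neq.
Qed.

Lemma better_ignored_move P D p q t :
  better P D p q -> turn p = opponent P -> legal q t -> ~ (In t D /\ legal p t) ->
  better P D (pass p) (play q t).
Proof.
  intros [T [B1 B2]] TP L N; unfold legal in *.
  split; [simpl; congruence | split]; intros s; simpl;
    destruct (tile_eq_dec s t) as [-> |]; auto.
  intros H; specialize (B1 t H); congruence.
Qed.

(** The strategy for [p] also serves in [q].  When it asks for a tile that [P]
    already owns in [q], any other free tile will do, the move being an extra
    one.  When the opponent plays in [q] on a tile outside [D], or on one that is
    blocked in [p], this is a pass in [p]. *)
Lemma forces_better P D D' p q :
  forces P D p -> incl D D' -> better P D p q -> forces P D' q.
Proof.
  intros H HD; revert q.
  induction H as [p W | p t T I L _ IH | p T _ IHpass _ IHplay]; intros q B.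
  - apply forces_won; revert W; apply wins_mono, B.
  - assert (Tq : turn q = P) by (destruct B; congruence).
    destruct (stones q t) as [X |] eqn:E.
    + assert (EP : stones q t = Some P).
      { destruct (classic (X = P)) as [-> | N]; [exact E | exfalso].
        apply (proj2 (proj2 B) t I L); rewrite E; f_equal; exact (neq_opponent _ _ N). }
      assert (Bp := better_pass_owned P D p q t B T EP).
      destruct (classic (filled D' (stones q))) as [F | F].
      * apply forces_won, (forces_filled P D' (pass q)); auto.
      * destruct (not_filled_free _ _ F) as [s [Is Ls]].
        apply forces_own with s; auto.
        apply IH, better_trans with (pass q); auto using better_extra_move.
    + apply forces_own with t; auto.
      apply IH, better_play; auto.
  - apply forces_opp.
    + destruct B; congruence.
    + apply IHpass, better_pass, B.
    + intros t _ L; destruct (classic (In t D /\ legal p t)) as [[I Lp] | N].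
      * apply (IHplay t I Lp), better_play; auto.
      * apply IHpass, better_ignored_move; auto.
Qed.

Lemma better_refl P D p : better P D p p.
Proof.
  split; [reflexivity | split; [auto |]]; intros t _ H; rewrite H; discriminate.
Qed.

Lemma forces_incl P D D' p : forces P D p -> incl D D' -> forces P D' p.
Proof. eauto using forces_better, better_refl. Qed.

(** * Positions with a game value are forced in a finite set *)

Lemma finite_union_of_replies (Q : list tile -> tile -> Prop) :
  (forall D D' t, Q D t -> incl D D' -> Q D' t) ->
  forall L, (forall t, In t L -> exists D, Q D t) ->
  forall D0, exists D, incl D0 D /\ forall t, In t L -> Q D t.
Proof.
  intros mono L; induction L as [| t L IH]; intros H D0.
  - exists D0; split; [apply incl_refl | intros t []].
  - destruct (H t (or_introl eq_refl)) as [Dt Ht].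
    destruct (IH (fun s Hs => H s (or_intror Hs)) (Dt ++ D0)) as [D [I K]].
    destruct (incl_app_inv _ _ I) as [It I0].
    exists D; split; [exact I0 |].
    intros s [<- | Hs]; [exact (mono _ _ _ Ht It) | exact (K s Hs)].
Qed.

(** The opponent's move at [t0] is at least as good for the opponent, against
    play in [D0], as any move outside [D0] and as a pass. *)
Lemma forces_opponent_turn P p t0 :
  turn p = opponent P -> legal p t0 ->
  (forall t, legal p t -> exists D, forces P D (play p t)) ->
  exists D, forces P D p.
Proof.
  intros T L0 H; destruct (H t0 L0) as [D0 H0].
  destruct (finite_union_of_replies (fun D t => legal p t -> forces P D (play p t)))
    with (L := D0) (D0 := D0) as [D [I K]].
  - intros D D' t F HD L; apply forces_incl with D; auto.
  - intros t _; destruct (classic (legal p t)) as [L | L].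
    + destruct (H t L) as [D F]; exists D; auto.
    + exists nil; contradiction.
  - unfold legal in L0; exists D; apply forces_opp; [exact T | |].
    + apply forces_better with D0 (play p t0); [exact H0 | exact I |].
      split; [reflexivity | split]; intros s; simpl; rewrite T;
        destruct (tile_eq_dec s t0) as [-> |]; try congruence.
      intros E; injection E; intros E'; destruct (opponent_neq P); congruence.
    + intros t _ L; unfold legal in L.
      destruct (in_dec tile_eq_dec t D0) as [It | Nt]; [exact (K t It L) |].
      apply forces_better with D0 (play p t0); [exact H0 | exact I |].
      split; [reflexivity | split]; intros s; simpl; rewrite T;
        destruct (tile_eq_dec s t0), (tile_eq_dec s t); subst; try congruence;
        intros E; injection E; intros E'; destruct (opponent_neq P); congruence.
Qed.

(** At the opponent's turn the values of the options need not be smaller than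
    that of the position, but after one more move of [P] they are.  So the
    induction on the value first treats, for all values up to a given one, the
    positions where [P] is to move. *)
Lemma game_value_ind P (G : position -> Prop) :
  (forall p, wins P (stones p) -> G p) ->
  (forall p t, turn p = P -> legal p t -> G (play p t) -> G p) ->
  (forall p t, turn p = opponent P -> legal p t ->
    (forall s, legal p s -> G (play p s)) -> G p) ->
  forall p, has_game_value P p -> G p.
Proof.
  intros Gwon Gown Gopp p [a [V [HV Va]]]; revert p Va.
  induction (olt_wf a) as [a _ IH].
  assert (Own : forall b q, ole b a -> turn q = P -> V q b -> G q).
  { intros b q B T Vq; apply HV in Vq.
    destruct Vq as [[W _] | [[_ [_ [c [[[t [L Vt]] _] [_ E]]]]] | [_ [T' _]]]].
    - exact (Gwon q W).
    - apply Gown with t; auto; apply IH with c; [| exact Vt].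
      exact (olt_ole_trans _ _ _ (proj1 (osucc_ole _ _) E) B).
    - destruct (opponent_neq P); congruence. }
  intros p Va; assert (Va' := Va); apply HV in Va'.
  destruct Va' as [[W _] | [[_ [T _]] | [_ [T [[t L] [K [S _]]]]]]].
  - exact (Gwon p W).
  - exact (Own a p (ole_refl a) T Va).
  - apply Gopp with t; auto; intros s Ls; destruct (K s Ls) as [b Vb].
    apply Own with b; [| simpl; rewrite T; apply opponent_involutive | exact Vb].
    apply S; exists s; auto.
Qed.

Lemma game_value_forces P p : has_game_value P p -> exists D, forces P D p.
Proof.
  revert p; apply game_value_ind.
  - intros p W; exists nil; apply forces_won, W.
  - intros p t T L [D F]; exists (t :: D); apply forces_own with t; auto.
    + apply in_eq.
    + apply forces_incl with D; [exact F | apply incl_tl, incl_refl].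
  - intros p t T L H; exact (forces_opponent_turn P p t T L H).
Qed.

(** * Forced positions are intrinsically local *)

Lemma forces_own_move P D p :
  forces P D p -> turn p = P -> ~ filled D (stones p) ->
  exists t, In t D /\ legal p t /\ forces P D (play p t).
Proof.
  intros [q W | q t _ I L F | q T' _ _] T N.
  - destruct (not_filled_free _ _ N) as [t [I L]]; exists t.
    split; [exact I | split; [exact L | apply forces_won, wins_play; auto]].
  - eauto.
  - destruct (opponent_neq P); congruence.
Qed.

Lemma forces_opponent_move P D p t :
  forces P D p -> turn p = opponent P -> legal p t -> forces P D (play p t).
Proof.
  intros [q W | q s T' _ _ _ | q _ Fpass Fplay] T L.
  - apply forces_won, wins_play; auto.
  - destruct (opponent_neq P); congruence.
  - destruct (in_dec tile_eq_dec t D) as [I | N]; [auto |].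
    apply forces_better with D (pass q); [exact Fpass | apply incl_refl |].
    apply better_ignored_move; [apply better_refl | tauto ..].
Qed.

(** Unseen tiles are filled in from the initial position.  The turn is that of
    [P] because only [P] consults the strategy. *)
Definition imagined (P : player) (D : list tile) (p : position) (c : coloring)
    : position :=
  Position (fun t => if in_dec tile_eq_dec t D then c t else stones p t) P.

(** An implication, because a local strategy must answer with a free tile of [D]
    in every coloring that does not fill [D], forced or not. *)
Definition good_move (P : player) (D : list tile) (q : position) (t : tile) : Prop :=
  In t D /\ legal q t /\ (forces P D q -> forces P D (play q t)).

Definition forcing_strategy (P : player) (D : list tile) (p : position)
    (c : coloring) : tile :=
  epsilon (inhabits (0%Z, 0%Z)) (good_move P D (imagined P D p c)).

Lemma imagined_local P D p c c' :
  (forall t, In t D -> c t = c' t) -> imagined P D p c = imagined P D p c'.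
Proof.
  intros H; unfold imagined; f_equal; apply functional_extensionality; intros t.
  destruct (in_dec tile_eq_dec t D); auto.
Qed.

Lemma imagined_filled P D p c :
  filled D (stones (imagined P D p c)) -> filled D c.
Proof.
  intros F t I; specialize (F t I); simpl in F.
  destruct (in_dec tile_eq_dec t D); tauto.
Qed.

Lemma imagined_legal P D p c t :
  In t D -> legal (imagined P D p c) t -> c t = None.
Proof.
  unfold legal; simpl; destruct (in_dec tile_eq_dec t D); tauto.
Qed.

Lemma forcing_strategy_good P D p c :
  ~ filled D c ->
  good_move P D (imagined P D p c) (forcing_strategy P D p c).
Proof.
  intros N; unfold forcing_strategy; apply epsilon_spec.
  assert (N' : ~ filled D (stones (imagined P D p c))).
  { intros F; exact (N (imagined_filled _ _ _ _ F)). }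
  destruct (classic (forces P D (imagined P D p c))) as [F | F].
  - destruct (forces_own_move P D _ F eq_refl N') as [t [I [L Ft]]].
    exists t; repeat split; auto.
  - destruct (not_filled_free _ _ N') as [t [I L]].
    exists t; repeat split; [exact I | exact L | contradiction].
Qed.

Lemma forcing_strategy_local P D p : local_strategy D (forcing_strategy P D p).
Proof.
  split.
  - intros c c' H; unfold forcing_strategy.
    now rewrite (imagined_local P D p c c' H).
  - intros c N; destruct (forcing_strategy_good P D p c N) as [I [L _]].
    split; [exact I | exact (imagined_legal _ _ _ _ _ I L)].
Qed.

(** All that [imagined] has to get right about the unseen tiles. *)
Definition same_own_outside (P : player) (D : list tile) (p q : position) : Prop :=
  forall t, ~ In t D -> stones q t = Some P <-> stones p t = Some P.

Lemma better_imagined P D p q :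
  same_own_outside P D p q -> turn q = P ->
  better P D q (imagined P D p (stones q)) /\
  better P D (imagined P D p (stones q)) q.
Proof.
  intros S T; split; split; simpl; auto; split; intros t;
    specialize (S t); destruct (in_dec tile_eq_dec t D); try tauto;
    intros _ ->; discriminate.
Qed.

Lemma forces_intrinsically_local P D p : forces P D p -> intrinsically_local P p.
Proof.
  intros F; exists D, (forcing_strategy P D p).
  split; [apply forcing_strategy_local |].
  assert (Inv : forall q, arises P D (forcing_strategy P D p) p q ->
            forces P D q /\ same_own_outside P D p q).
  { intros q A; induction A as [| q _ [Fq S] T N | q t _ [Fq S] T L].
    - split; [exact F | intros t _; reflexivity].
    - destruct (forcing_strategy_good P D p (stones q) N) as [I [L G]].
      destruct (better_imagined P D p q S T) as [B1 B2].
      assert (Lq := imagined_legal _ _ _ _ _ I L).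
      set (t := forcing_strategy P D p (stones q)) in *; split.
      + apply forces_better with D (play (imagined P D p (stones q)) t).
        * apply G, forces_better with D q; auto using incl_refl.
        * apply incl_refl.
        * apply better_play; auto.
      + intros s Hs; simpl; destruct (tile_eq_dec s t) as [-> |]; [tauto | auto].
    - split; [exact (forces_opponent_move P D q t Fq T L) |].
      intros s Hs; specialize (S s Hs); simpl.
      destruct (tile_eq_dec s t) as [-> |]; [| exact S].
      rewrite <- S, L, T; split; [| discriminate].
      intros E; injection E; intros E'; destruct (opponent_neq P); congruence. }
  intros q A Fq; destruct (Inv q A) as [H _]; exact (forces_filled P D q H Fq).
Qed.

Theorem theorem18 :
  forall (P : player) (p : position),
    has_game_value P p -> intrinsically_local P p.
Proof.
  intros P p H; destruct (game_value_forces P p H) as [D F].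
  exact (forces_intrinsically_local P D p F).
Qed.
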